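(* Let $N$ be a lattice of rank $d$, let $\Sigma$ be a complete simplicial rational fan in $N_{\mathbb{R}}$ with rays $\rho_1,\dots,\rho_r$ having primitive generators $v_1,\dots,v_r$, and let $b_i=a_iv_i$ with $a_i$ positive integers. For every rational number $-1<k\le 0$, there is a polynomial $F_k\in\mathbb{Q}[t]$ with $F_k(m)=f^0_k(m)$ for all integers $m\ge0$, and $F_k$ is either identically zero or of degree $d$ with positive leading coefficient. Moreover, for every positive integer $m$, \[F_k(-m)=\begin{cases}(-1)^d F_k(m-1) & \text{if } k=0,\\ (-1)^d F_{-1-k}(m) & \text{if } -1<k<0.\end{cases}\]
   Context: Let $\psi:N_{\mathbb{R}}\to\mathbb{R}$ be the function linear on each cone of $\Sigma$ with $\psi(b_i)=1$ for all $i$, and $Q=\{v:\psi(v)\le1\}$. For $v\in N$ define the weight $w_0(v)=\psi(v)-\lceil\psi(v)\rceil\in(-1,0]$. For a rational $k$ and integer $m\ge0$, $f^0_k(m)$ is the number of lattice points $v\in mQ\cap N$ with $w_0(v)=k$. *)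

(* Defs.v *)
From HB Require Import structures.
From mathcomp Require Import all_boot all_order all_algebra finmap.
From mathcomp Require Import boolp classical_sets functions cardinality reals.
Set Implicit Arguments.
Unset Strict Implicit.
Unset Printing Implicit Defensive.
Import Order.TTheory GRing.Theory Num.Theory.
Local Open Scope classical_set_scope.
Local Open Scope ring_scope.

Section Lattices.
Context {R : realType} {V : vectType R}.
Implicit Types (N : set V) (v w : V).

(* The ambient space V plays the role of N_R: the lattice N is the Z-span of
   an R-basis of V, so that V is canonically the tensor product of N and R. *)
Definition lattice_of_rank (d : nat) N : Prop :=
  exists2 e : d.-tuple V, basis_of fullv e &
    N = [set x | exists z : 'I_d -> int, x = \sum_(i < d) e`_i *~ z i].

(* The case n = 0 makes this fail for v = 0. *)
Definition primitive N v : Prop :=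
  N v /\ forall w (n : nat), N w -> v = w *+ n -> n = 1%N.

End Lattices.

Section Fans.
Context {R : realType} {V : vectType R}.
Implicit Types (N : set V) (s : seq V) (sigma tau : set V).
Implicit Types (Sigma : set (set V)).

Definition cone s : set V :=
  [set x | exists2 c : 'I_(size s) -> R,
     forall i, 0 <= c i & x = \sum_(i < size s) c i *: s`_i].

Definition rational_cone N sigma : Prop :=
  exists2 s, forall x, x \in s -> N x & sigma = cone s.

Definition strongly_convex sigma : Prop :=
  forall x, sigma x -> sigma (- x) -> x = 0.

Definition simplicial_cone sigma : Prop :=
  exists2 s, free s & sigma = cone s.

Definition face tau sigma : Prop :=
  exists2 u : {scalar V}, forall x, sigma x -> 0 <= u x &
    tau = sigma `&` [set x | u x = 0].

Definition is_ray sigma : Prop :=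
  exists2 x : V, x != 0 & sigma = cone [:: x].

Record rational_fan N Sigma : Prop := RationalFan {
  fan_finite : finite_set Sigma;
  fan_nonempty : Sigma !=set0;
  fan_rational : forall sigma, Sigma sigma -> rational_cone N sigma;
  fan_strongly_convex : forall sigma, Sigma sigma -> strongly_convex sigma;
  fan_face : forall sigma tau, Sigma sigma -> face tau sigma -> Sigma tau;
  fan_meet : forall sigma tau, Sigma sigma -> Sigma tau ->
    face (sigma `&` tau) sigma /\ face (sigma `&` tau) tau }.

Definition simplicial_fan Sigma : Prop :=
  forall sigma, Sigma sigma -> simplicial_cone sigma.

Definition complete_fan Sigma : Prop :=
  \bigcup_(sigma in Sigma) sigma = [set: V].

Definition linear_on_cones Sigma (psi : V -> R) : Prop :=
  forall sigma, Sigma sigma ->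
    exists u : {scalar V}, forall x, sigma x -> psi x = u x.

End Fans.

Section Counting.
Context {R : realType} {V : vectType R}.
Implicit Types (N : set V) (psi : V -> R).

Definition Qset psi : set V := [set x | psi x <= 1].

Definition dilate (m : nat) (A : set V) : set V := [set m%:R *: x | x in A].

Definition w0 psi (x : V) : R := psi x - (Num.ceil (psi x))%:~R.

(* [fset_set] is the empty finite set on an infinite set; for a complete
   simplicial fan the dilates of Q are bounded, so that these sets of lattice
   points are finite. *)
Definition f0 N psi (k : rat) (m : nat) : nat :=
  #|` fset_set [set x | [/\ dilate m (Qset psi) x, N x & w0 psi x = ratr k]] |.

End Counting.

(* Main.v *)
Require Import Defs.
From HB Require Import structures.
From mathcomp Require Import all_boot all_order all_algebra finmap.
From mathcomp Require Import boolp classical_sets functions cardinality reals.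
From mathcomp Require Import zify ring lra.
Set Implicit Arguments.
Unset Strict Implicit.
Unset Printing Implicit Defensive.
Import Order.TTheory GRing.Theory Num.Theory.
Local Open Scope classical_set_scope.
Local Open Scope ring_scope.

(* Choose w outside the span of every non-maximal cone and outside every facet
   hyperplane of the maximal cones. Every x then lies in exactly one maximal
   cone from which the facets not facing w have been removed (the cone containing
   x + eps w for all small eps > 0), so N is partitioned into the lattice points
   of half-open simplicial cones, all of dimension d. In a half-open cone with
   generators b_1, ..., b_d, a lattice point is uniquely y + sum_i n_i b_i with y
   in the half-open box and n_i natural; psi grows by n_1 + ... + n_d and w0 is
   unchanged, so y contributes binomial(m - ceil (psi y) + d, d) to f0(m). The
   map y |-> sum_i b_i - y exchanges the boxes for w and for -w, and since both
   choices compute f0, reciprocity for binomial coefficients gives the theorem. *)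

(** * Binomial polynomials and their reciprocity *)

(* The polynomial t |-> binomial(t - c + d, d). *)
Definition binom_poly (d : nat) (c : int) : {poly rat} :=
  d`!%:R^-1 *: \prod_(i < d) ('X - (c%:~R - i.+1%:R)%:P).

Lemma horner_binom_poly d c x :
  (binom_poly d c).[x] = d`!%:R^-1 * \prod_(i < d) (x - c%:~R + i.+1%:R).
Proof.
rewrite hornerZ horner_prod; congr (_ * _).
by apply: eq_bigr => i _; rewrite hornerXsubC opprB addrA addrAC.
Qed.

Lemma size_binom_poly d c : size (binom_poly d c) = d.+1.
Proof.
rewrite size_scale ?size_prod_XsubC ?invr_eq0 ?pnatr_eq0 -?lt0n ?fact_gt0 //.
by rewrite /index_enum -enumT size_enum_ord.
Qed.

Lemma lead_coef_binom_poly d c : lead_coef (binom_poly d c) = d`!%:R^-1.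
Proof. by rewrite lead_coefZ (monicP (monic_prod_XsubC _ _ _)) mulr1. Qed.

Lemma prod_addn_rising (d e : nat) :
  (\prod_(i < d) (e + i.+1) * e`! = (e + d)`!)%N.
Proof.
elim: d => [|d IHd]; first by rewrite big_ord0 mul1n addn0.
by rewrite big_ord_recr /= mulnAC IHd addnS factS mulnC.
Qed.

(** For natural [m] below [c], the bound [c <= d] puts [c - m] between 1 and [d], so a linear factor
    vanishes at [m]; otherwise the product is a rising factorial. *)
Lemma binom_poly_nat d (c : int) (m : nat) : c <= d%:Z ->
  (binom_poly d c).[m%:R] = (if c <= m%:Z then 'C(d + `|m%:Z - c|, d) else 0)%:R.
Proof.
move=> cd; rewrite horner_binom_poly; case: ifPn => cm.
  set e := `|_|%N; have em : m%:R - c%:~R = e%:R :> rat.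
    by rewrite -[e%:R]/(e%:Z%:~R) -[m%:R]/(m%:Z%:~R) -intrB; congr (_%:~R); lia.
  under eq_bigr => i _ do rewrite em -natrD.
  rewrite -natr_prod; apply: (mulfI (x := (d`! * e`!)%:R)).
    by rewrite pnatr_eq0 -lt0n muln_gt0 !fact_gt0.
  have := bin_fact (leq_addr e d); rewrite addKn => binE.
  rewrite -[RHS]natrM [in RHS]mulnC binE addnC -prod_addn_rising !natrM mulrACA.
  by rewrite divff ?mul1r 1?mulrC // pnatr_eq0 -lt0n fact_gt0.
have h : (`|c - m%:Z|.-1 < d)%N by lia.
suff root : m%:R - c%:~R + (Ordinal h).+1%:R = 0 :> rat.
  by rewrite (bigD1 (Ordinal h)) //= root mul0r mulr0.
rewrite -[_.+1%:R]/(_.+1%:Z%:~R) -[m%:R]/(m%:Z%:~R) -intrB -intrD /=.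
by apply/eqP; rewrite intr_eq0; apply/eqP; lia.
Qed.

(** Each of the [d] factors changes sign, and the product is then read in reverse order. *)
Lemma binom_polyN d c x :
  (binom_poly d c).[- x] = (-1) ^+ d * (binom_poly d (d%:Z + 1 - c)).[x].
Proof.
rewrite !horner_binom_poly mulrCA; congr (_ * _).
rewrite -[X in _ ^+ X]card_ord -prodr_const -big_split /= [RHS](reindex_inj rev_ord_inj) /=.
apply: eq_bigr => i _; rewrite subnSK ?ltn_ord // natrB ?(ltnW (ltn_ord i)) //.
by rewrite intrB intrD /= -[d%:~R]/(d%:R) -natr1; ring.
Qed.

Lemma binom_poly_shift d c x :
  (binom_poly d (c + 1)).[x] = (binom_poly d c).[x - 1].
Proof.
rewrite !horner_binom_poly; congr (_ * _); apply: eq_bigr => i _.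
by rewrite intrD; ring.
Qed.

(** All summands have degree [d] and the same positive leading coefficient, so nothing cancels; the
    sum is zero only when [cs] is empty. *)
Lemma sum_binom_poly_lead d (cs : seq int) :
  let F := \sum_(c <- cs) binom_poly d c in
  F = 0 \/ (size F = d.+1 /\ 0 < lead_coef F).
Proof.
move=> F; case: (altP (size cs =P 0%N)) => [/size0nil cs0|cs0].
  by left; rewrite /F cs0 big_nil.
right; have szF : (size F <= d.+1)%N.
  apply: (leq_trans (size_sum _ _ _)); apply/bigmax_leqP_seq => c _ _.
  by rewrite size_binom_poly.
have Fd : F`_d = (size cs)%:R / d`!%:R.
  rewrite /F coef_sum (eq_bigr (fun=> d`!%:R^-1)) => [|c _].
    by rewrite big_const_seq count_predT iter_addr_0 mulr_natl.
  by rewrite -(lead_coef_binom_poly d c) lead_coefE size_binom_poly.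
have Fd_gt0 : 0 < F`_d by rewrite Fd divr_gt0 // ltr0n ?lt0n // -lt0n fact_gt0.
have szE : size F = d.+1.
  apply/eqP; rewrite eqn_leq szF ltnNge; apply/negP => le.
  by move: Fd_gt0; rewrite nth_default ?ltxx.
by rewrite lead_coefE szE.
Qed.

(** * Counting sequences of naturals with bounded sum *)

(** A sum at most [n] bounds every entry by [n], so tuples over the finite type ['I_n.+1] lose
    nothing. *)
Definition bounded_seqs (d n : nat) : seq (seq nat) :=
  [seq map val (val t) |
     t <- enum [set t : d.-tuple 'I_n.+1 | (\sum_(i <- t) i <= n)%N]%SET].

Lemma size_bounded_seqs d n : size (bounded_seqs d n) = 'C(d + n, d).
Proof. by rewrite size_map -cardE card_partial_ord_partitions. Qed.

Lemma bounded_seqs_uniq d n : uniq (bounded_seqs d n).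
Proof.
rewrite map_inj_uniq ?enum_uniq // => t u eq_tu.
by apply/val_inj/(inj_map val_inj).
Qed.

Lemma mem_bounded_seqs d n (t : seq nat) :
  (t \in bounded_seqs d n) = (size t == d) && (sumn t <= n)%N.
Proof.
apply/mapP/andP => [[u]|[/eqP szt le_tn]].
  rewrite mem_enum inE => le_un ->; rewrite size_map size_tuple eqxx; split=> //.
  by rewrite sumnE big_map.
have le_in x : x \in t -> (x <= n)%N.
  move=> xt; apply: leq_trans le_tn.
  by rewrite sumnE (big_rem x) //= leq_addr.
have szt' : size [seq inord i : 'I_n.+1 | i <- t] == d by rewrite size_map szt.
have tE : [seq val i | i <- [seq inord i : 'I_n.+1 | i <- t]] = t.
  rewrite -map_comp -[RHS]map_id; apply/eq_in_map => x xt /=.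
  by rewrite inordK // ltnS le_in.
exists (Tuple szt'); last by rewrite /= tE.
rewrite mem_enum inE -(big_map val xpredT (fun i : nat => i)) /= tE.
by rewrite -sumnE.
Qed.

Lemma card_fset_set_seq (T : choiceType) (A : set T) (s : seq T) :
  uniq s -> (forall x, x \in s <-> A x) -> #|` fset_set A| = size s.
Proof.
move=> s_uniq sP; have -> : A = [set` [fset x in s]%fset].
  by apply/seteqP; split=> x; rewrite /mkset inE /= => /sP.
by rewrite set_fsetK card_fseq undup_id.
Qed.

(** * Half-open simplicial cones and their boxes *)

Section HalfOpen.
Context {R : realType} {V : vectType R} {d : nat}.
Implicit Types (N : set V) (psi : V -> R) (b : d.-tuple V) (s : 'I_d -> bool).
Implicit Types (x y : V).

Lemma lattice_addmul N (k : int) x y :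
  lattice_of_rank d N -> N x -> N y -> N (x + y *~ k).
Proof.
move=> [e _ ->] [zx ->] [zy ->]; exists (fun i => zx i + zy i * k).
rewrite mulrz_suml -big_split; apply: eq_bigr => i _ /=.
by rewrite mulrzDr mulrzA.
Qed.

Lemma lattice0 N : lattice_of_rank d N -> N 0.
Proof.
move=> [e _ ->]; exists (fun=> 0).
by rewrite big1 // => i _; rewrite mulr0z.
Qed.

Lemma lattice_mulrz N (k : int) x : lattice_of_rank d N -> N x -> N (x *~ k).
Proof.
by move=> hN Nx; rewrite -[_ *~ _]add0r; apply: lattice_addmul => //; exact: lattice0.
Qed.

Lemma lattice_sum N (I : Type) (r : seq I) (F : I -> V) :
  lattice_of_rank d N -> (forall i, N (F i)) -> N (\sum_(i <- r) F i).
Proof.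
move=> hN NF; elim/big_ind: _ => [|x y Nx Ny|i _]; [exact: lattice0| |exact: NF].
by rewrite -[y]mulr1z; exact: lattice_addmul.
Qed.

Lemma coord_sum_free b (c : 'I_d -> R) (j : 'I_d) : free b ->
  coord b j (\sum_(i < d) c i *: b`_i) = c j.
Proof.
move=> bfree; rewrite linear_sum (bigD1 j) //= linearZ /=.
rewrite coord_free // eqxx mulr1 big1 ?addr0 // => i ij.
by rewrite linearZ /= coord_free // (negPf ij) mulr0.
Qed.

Lemma coord_sum_basis b (c : 'I_d -> R) (j : 'I_d) : basis_of fullv b ->
  coord b j (\sum_(i < d) c i *: b`_i) = c j.
Proof. by move=> /basis_free; exact: coord_sum_free. Qed.

(** The integer coordinates of [x] in the lattice basis [e] depend linearly on its bounded
    coordinates in [b], so they are bounded by a common [K]. *)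
Lemma lattice_finite N b (M : R) : lattice_of_rank d N -> basis_of fullv b ->
  finite_set [set x | N x /\ forall i, 0 <= coord b i x <= M].
Proof.
move=> [e e_basis NE] b_basis.
pose B i := \sum_(j < d) M * `|coord e i b`_j|.
pose K := (\sum_(i < d) Num.bound (B i))%N.
(* Integers between [-K] and [K] are encoded in ['I_(2 * K).+1] by adding [K]. *)
pose g (f : {ffun 'I_d -> 'I_(2 * K).+1}) :=
  \sum_(i < d) e`_i *~ ((f i)%:Z - K%:Z).
apply: (@sub_finite_set _ _ (range g)); last exact: finite_image.
move=> x [Nx xM]; move: (Nx); rewrite {1}NE => -[z xE].
have zE i : (z i)%:~R = coord e i x.
  rewrite xE -(coord_sum_basis (fun i => (z i)%:~R) i e_basis).
  by congr (coord _ _ _); apply: eq_bigr => j _; rewrite scaler_int.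
have zK i : `|z i| <= K%:Z.
  rewrite -(ler_int R) intr_norm zE.
  apply: (@le_trans _ _ (B i)); last first.
    have B0 : 0 <= B i.
      apply: sumr_ge0 => j _; rewrite mulr_ge0 //.
      by have /andP[] := xM i; exact: le_trans.
    apply: ltW (lt_le_trans (archi_boundP B0) _).
    by rewrite ler_nat /K (bigD1 i) //= leq_addr.
  rewrite {1}(coord_basis b_basis (memvf x)) linear_sum.
  apply: le_trans (ler_norm_sum _ _ _) _; apply: ler_sum => j _.
  rewrite linearZ /= normrM ler_wpM2r //.
  by have /andP[? ?] := xM j; rewrite ger0_norm.
exists [ffun i => inord (absz (z i + K%:Z))] => //.
rewrite /g xE; apply: eq_bigr => i _; rewrite ffunE inordK; have := zK i; last by lia.
by move=> zKi; congr (_ *~ _); lia.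
Qed.

(** The flag [s i] says that the facet where coordinate [i] vanishes is kept. *)
Definition half_open s b : pred V :=
  fun x => [forall i, 0 < coord b i x ?<= if s i].

(* The upper bounds 0 < 1 - coord b i y, non-strict where s i is false, are
   expressed on sum_i b_i - y to make the reflection symmetry visible. *)
Definition box N s b : set V :=
  [set y | [/\ N y, half_open s b y &
    half_open (fun i => ~~ s i) b (\sum_(i < d) b`_i - y)]].

Lemma coord_sub b x i : basis_of fullv b ->
  coord b i (\sum_(j < d) b`_j - x) = 1 - coord b i x.
Proof.
move=> b_basis; rewrite linearB /=; congr (_ - _).
rewrite -[RHS](coord_sum_basis (fun=> 1) i b_basis).
by congr (coord _ _ _); apply: eq_bigr => j _; rewrite scale1r.
Qed.

Lemma half_open_ge0 s b x i : half_open s b x -> 0 <= coord b i x.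
Proof. by move=> /forallP/(_ i)/lteifW. Qed.

Lemma finite_box N s b : lattice_of_rank d N -> basis_of fullv b ->
  finite_set (box N s b).
Proof.
move=> hN b_basis; apply: sub_finite_set (lattice_finite 1 hN b_basis).
move=> y [Ny hy hy']; split=> // i; rewrite (half_open_ge0 _ hy) /=.
by have := half_open_ge0 i hy'; rewrite coord_sub // subr_ge0.
Qed.

Lemma mem_box N s b y : lattice_of_rank d N -> basis_of fullv b ->
  y \in (fset_set (box N s b) : seq V) <-> box N s b y.
Proof.
by move=> hN b_basis; rewrite in_fset_set ?inE //; exact: finite_box.
Qed.

Lemma box_reflect N s b y : lattice_of_rank d N -> (forall i : 'I_d, N b`_i) ->
  box N s b y -> box N (fun i => ~~ s i) b (\sum_(i < d) b`_i - y).
Proof.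
move=> hN Nb [Ny hy hy']; split=> //.
  rewrite -[- y](mulrN1z); apply: lattice_addmul => //; exact: lattice_sum.
rewrite subKr; apply/forallP => i; rewrite negbK; exact: (forallP hy).
Qed.

Definition shift b y (t : seq nat) : V :=
  y + \sum_(i < d) (nth 0%N t i)%:R *: b`_i.

Lemma coord_shift b y t i : basis_of fullv b ->
  coord b i (shift b y t) = coord b i y + (nth 0%N t i)%:R.
Proof. by move=> b_basis; rewrite linearD /= coord_sum_basis. Qed.

Lemma half_open_shift s b y t : basis_of fullv b ->
  half_open s b y -> half_open s b (shift b y t).
Proof.
move=> b_basis /forallP hy; apply/forallP => i; rewrite coord_shift //.
move: (hy i); case: (s i) => /=.
  by move=> ?; rewrite addr_ge0.
by move=> ?; rewrite ltr_wpDr.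
Qed.

(** The unit interval is [0, 1) when [e] holds and (0, 1] otherwise, so [n] is the floor of [c] in
    the first case and its ceiling minus 1 in the second. *)
Lemma nat_part_exists (e : bool) (c : R) : 0 < c ?<= if e ->
  exists n : nat,
    (0 < c - n%:R ?<= if e) && (0 < 1 - (c - n%:R) ?<= if ~~ e).
Proof.
case: e => /= c0.
  have f0 : 0 <= Num.floor c by rewrite floor_ge0.
  exists `|Num.floor c|%N; rewrite natr_absz ger0_norm //.
  have /andP[] := floor_itv c; rewrite intrD => ? ?.
  by apply/andP; split; lra.
have f0 : 0 < Num.ceil c by rewrite ceil_gt0.
exists (absz (Num.ceil c - 1)); rewrite natr_absz ger0_norm; last by lia.
have /andP[] := ceil_itv c; rewrite intrB => ? ?.
by apply/andP; split; lra.
Qed.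

Lemma nat_part_unique (e : bool) (c c' : R) (n n' : nat) :
    0 < c ?<= if e -> 0 < 1 - c ?<= if ~~ e ->
    0 < c' ?<= if e -> 0 < 1 - c' ?<= if ~~ e ->
  c + n%:R = c' + n'%:R -> n = n'.
Proof.
move=> c0 c1 c0' c1' E.
have : `|n%:Z - n'%:Z| < 1.
  rewrite -(ltr_int R) intr_norm intrB ltr_norml.
  by move: E c0 c1 c0' c1'; rewrite -!pmulrn; case: e => /= E c0 c1 c0' c1'; apply/andP; split; lra.
lia.
Qed.

Lemma box_shift_exists N s b x : lattice_of_rank d N ->
    basis_of fullv b -> (forall i : 'I_d, N b`_i) ->
    N x -> half_open s b x ->
  exists y t, [/\ box N s b y, size t = d & x = shift b y t].
Proof.
move=> hN b_basis Nb Nx /forallP hx.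
have [n nP] := choice (fun i => nat_part_exists (hx i)).
pose t := [seq n i | i : 'I_d].
have tE (i : 'I_d) : nth 0%N t i = n i.
  by rewrite (nth_map i) ?size_enum_ord // nth_ord_enum.
exists (x - \sum_(i < d) (n i)%:R *: b`_i), t; split.
- split.
  + rewrite -[- _](mulrN1z); apply: lattice_addmul => //.
    by apply: lattice_sum => // i; rewrite scaler_nat pmulrn; exact: lattice_mulrz.
  + apply/forallP => i; rewrite linearB /= coord_sum_basis //.
    by have /andP[] := nP i.
  + apply/forallP => i; rewrite coord_sub // linearB /= coord_sum_basis //.
    by have /andP[] := nP i.
- by rewrite size_map size_enum_ord.
- by rewrite /shift; under [X in _ + X]eq_bigr do rewrite tE; rewrite subrK.
Qed.

Lemma box_shift_inj N s b y t y' t' : basis_of fullv b ->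
    box N s b y -> box N s b y' -> size t = d -> size t' = d ->
  shift b y t = shift b y' t' -> y = y' /\ t = t'.
Proof.
move=> b_basis [_ /forallP hy /forallP ky] [_ /forallP hy' /forallP ky'] szt szt' E.
have tt' : t = t'.
  apply: (@eq_from_nth _ 0%N); rewrite szt ?szt' // => i id.
  have := congr1 (coord b (Ordinal id)) E; rewrite !coord_shift //.
  move: (ky (Ordinal id)) (ky' (Ordinal id)); rewrite !coord_sub // => k k'.
  exact: nat_part_unique k (hy' _) k'.
by split=> //; move: E; rewrite /shift tt' => /addIr.
Qed.

End HalfOpen.

(** * Lattice points of one half-open cone, by weight and height *)

Section Counting.
Context {R : realType} {V : vectType R} {d : nat}.
Variables (N : set V) (psi : V -> R).
Hypothesis hN : lattice_of_rank d N.
Implicit Types (b : d.-tuple V) (s : 'I_d -> bool) (k : rat) (m : nat).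
Implicit Types (x y : V).

(** The last clause combines linearity of [psi] on the cone with the value 1 on each generator. *)
Definition cone_basis b : Prop :=
  [/\ basis_of fullv b, forall i : 'I_d, N b`_i &
      forall x, (forall i, 0 <= coord b i x) -> psi x = \sum_(i < d) coord b i x].

Lemma psi_half_open s b x : cone_basis b -> half_open s b x ->
  psi x = \sum_(i < d) coord b i x.
Proof. by move=> [_ _ psiE] hx; apply: psiE => i; exact: half_open_ge0 hx. Qed.

Lemma psi_shift s b y (t : seq nat) : cone_basis b -> size t = d ->
  half_open s b y -> psi (shift b y t) = psi y + (sumn t)%:R.
Proof.
move=> hb szt hy; have [b_basis _ _] := hb.
rewrite (psi_half_open hb (half_open_shift t b_basis hy)) (psi_half_open hb hy).
under eq_bigr do rewrite coord_shift //.
rewrite big_split sumnE (big_nth 0%N) big_mkord szt natr_sum; congr (_ + _).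
Qed.

Lemma w0_addn x y (n : nat) : psi x = psi y + n%:R -> w0 psi x = w0 psi y.
Proof.
move=> E; rewrite /w0 E ceilDrz ?natr_int // intrD pmulrn intrKceil.
by rewrite opprD addrACA subrr addr0.
Qed.

Definition box_points k s b : seq V :=
  [seq y <- fset_set (box N s b) : seq V | w0 psi y == ratr k].

Definition heights k s b : seq int :=
  [seq Num.ceil (psi y) | y <- box_points k s b].

(** Without the test, [absz] would turn a negative remaining height [m - c] into a positive one. *)
Definition shifts m (c : int) : seq (seq nat) :=
  if c <= m%:Z then bounded_seqs d (absz (m%:Z - c)) else [::].

Definition cone_points k m s b : seq V :=
  [seq shift b y t | y <- box_points k s b, t <- shifts m (Num.ceil (psi y))].

Lemma mem_box_points k s b y : cone_basis b ->
  y \in box_points k s b <-> box N s b y /\ w0 psi y = ratr k.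
Proof.
move=> [b_basis _ _]; rewrite mem_filter -(mem_box _ _ hN b_basis).
by split=> [/andP[/eqP]|[? ->]]; rewrite ?eqxx.
Qed.

Lemma mem_shifts m c (t : seq nat) :
  (t \in shifts m c) = (size t == d) && (c + (sumn t)%:Z <= m%:Z).
Proof.
rewrite /shifts; case: ifP => cm; rewrite ?mem_bounded_seqs ?in_nil.
  by congr (_ && _); lia.
by symmetry; apply/negbTE; rewrite negb_and; apply/orP; right; lia.
Qed.

(** Since [sumn t] and [m] are integers, the condition [psi y + sumn t <= m] depends on [psi y] only
    through its ceiling. *)
Lemma mem_cone_points k m s b x : cone_basis b ->
  x \in cone_points k m s b <->
    [/\ N x, half_open s b x, psi x <= m%:R & w0 psi x = ratr k].
Proof.
move=> hb; have [b_basis Nb _] := hb.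
have leE y t : size t = d -> half_open s b y ->
    (Num.ceil (psi y) + (sumn t)%:Z <= m%:Z) = (psi (shift b y t) <= m%:R).
  move=> szt hy; rewrite (psi_shift hb szt hy) -lerBrDr ceil_le_int intrB.
  by rewrite -!pmulrn lerBrDr.
split.
  move=> /allpairsPdep[y [t [/(mem_box_points _ _ _ hb)[[Ny hy hy'] wy]]]].
  rewrite mem_shifts => /andP[/eqP szt le_tm] ->; split.
  - rewrite /shift -[X in _ + X]mulr1z; apply: (lattice_addmul _ hN) => //.
    by apply: (lattice_sum _ hN) => i; rewrite scaler_nat pmulrn; exact: (lattice_mulrz _ hN).
  - exact: half_open_shift.
  - by rewrite -leE.
  - by rewrite -wy; apply: w0_addn; exact: psi_shift hb szt hy.
move=> [Nx hx xm wx].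
have [y [t [yB szt xE]]] := box_shift_exists hN b_basis Nb Nx hx.
have hy : half_open s b y by case: yB.
apply/allpairsPdep; exists y, t; split=> //.
  apply/mem_box_points => //; split=> //; rewrite -wx xE.
  by symmetry; apply: w0_addn; exact: psi_shift hb szt hy.
by rewrite mem_shifts szt eqxx leE // -xE.
Qed.

Lemma cone_points_uniq k m s b : cone_basis b -> uniq (cone_points k m s b).
Proof.
move=> hb; have [b_basis _ _] := hb; apply: allpairs_uniq_dep.
- by rewrite filter_uniq // fset_uniq.
- by move=> y _; rewrite /shifts; case: ifP => // _; exact: bounded_seqs_uniq.
move=> _ _ /allpairsPdep[y [t [yB + ->]]] /allpairsPdep[y' [t' [yB' + ->]]] /=.
rewrite !mem_shifts => /andP[/eqP szt _] /andP[/eqP szt' _] E.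
have [yB1 _] := (mem_box_points k s y hb).1 yB.
have [yB1' _] := (mem_box_points k s y' hb).1 yB'.
by have [-> ->] := box_shift_inj b_basis yB1 yB1' szt szt' E.
Qed.

Lemma size_cone_points k m s b : size (cone_points k m s b) =
  (\sum_(c <- heights k s b)
    if (c <= m%:Z)%R then 'C(d + absz (m%:Z - c)%R, d) else 0)%N.
Proof.
rewrite size_allpairs_dep sumnE !big_map; apply: eq_bigr => y _.
by rewrite /shifts; case: ifP => //; rewrite size_bounded_seqs.
Qed.

(** Coordinates of a box point are at most 1 and [psi] is their sum; the bound is what
    [binom_poly_nat] requires. *)
Lemma heights_le k s b c : cone_basis b -> c \in heights k s b -> c <= d%:Z.
Proof.
move=> hb /mapP[y /(mem_box_points _ _ _ hb)[[Ny hy hy'] _] ->].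
have [b_basis _ _] := hb.
rewrite ceil_le_int (psi_half_open hb hy) -pmulrn -[X in X%:R]card_ord -sumr_const.
apply: ler_sum => i _.
by have := half_open_ge0 i hy'; rewrite coord_sub // subr_ge0.
Qed.

Lemma size_cone_points_poly k m s b : cone_basis b ->
  (size (cone_points k m s b))%:R =
  (\sum_(c <- heights k s b) binom_poly d c).[m%:R].
Proof.
move=> hb; rewrite size_cone_points natr_sum horner_sum [LHS]big_seq [RHS]big_seq.
apply: eq_bigr => c /(heights_le hb) cd.
by rewrite binom_poly_nat.
Qed.

Definition dual_weight k : rat := if k == 0 then 0 else - 1 - k.

(** If [psi x = c + k], the reflected point has [psi] equal to [(d - c) - k]. For [k < 0] the number
    [-k] lies in (0, 1), so the ceiling is one more than [d - c]. *)
Definition dual_height k (c : int) : int :=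
  if k == 0 then d%:Z - c else d%:Z + 1 - c.

Lemma dual_weight_range k : -1 < k <= 0 -> -1 < dual_weight k <= 0.
Proof.
rewrite /dual_weight; case: eqP => // /eqP k0 /andP[k1 k2].
have {}k0 : k < 0 by rewrite lt_neqAle k0.
by apply/andP; split; lra.
Qed.

Lemma dual_weightK k : -1 < k <= 0 -> dual_weight (dual_weight k) = k.
Proof.
rewrite /dual_weight => /andP[k1 _]; case: (eqVneq k 0) => [->|k0]; first by rewrite eqxx.
by case: eqP => [E|_]; lra.
Qed.

Lemma w0_reflect k x y : -1 < k <= 0 -> psi y = d%:R - psi x ->
    w0 psi x = ratr k ->
  w0 psi y = ratr (dual_weight k) /\
  Num.ceil (psi y) = dual_height k (Num.ceil (psi x)).
Proof.
rewrite /w0 => /andP[k1 k2] yE xk; set c := Num.ceil (psi x).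
have {}xk : psi x = c%:~R + ratr k by rewrite -xk addrC subrK.
move: k1 k2; rewrite -(ltr_rat R) -(ler_rat R) rmorphN1 rmorph0 => k1 k2.
have cE : Num.ceil (psi y) = dual_height k c.
  apply: ceil_def; rewrite yE xk /dual_height.
  case: eqP xk => [->|/eqP k0] xk; rewrite ?rmorph0 !(intrB, intrD) -!pmulrn.
    by apply/andP; split; lra.
  have {}k0 : ratr k != 0 :> R by rewrite fmorph_eq0.
  by apply/andP; split; lra.
split=> //; rewrite cE yE xk /dual_height /dual_weight.
case: eqP xk => [->|_] xk; rewrite ?rmorph0 !(intrB, intrD) -!pmulrn; first by ring.
by rewrite rmorphB rmorphN1; ring.
Qed.

(** The reflection [y |-> sigma - y] is a bijection between the boxes with complementary flags, and
    [w0_reflect] gives its effect on weight and height. *)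
Lemma perm_heights k s b : -1 < k <= 0 -> cone_basis b ->
  perm_eq (heights (dual_weight k) (fun i => ~~ s i) b)
          (map (dual_height k) (heights k s b)).
Proof.
move=> hk hb; have [b_basis Nb _] := hb.
pose sigma := \sum_(i < d) b`_i.
have psi_sigma s' y : box N s' b y -> psi (sigma - y) = d%:R - psi y.
  move=> [_ hy hy']; rewrite (psi_half_open hb hy) (psi_half_open hb hy').
  under eq_bigr do rewrite coord_sub //.
  by rewrite sumrB sumr_const card_ord.
have reflect_mem k' s' y : -1 < k' <= 0 -> y \in box_points k' s' b ->
    sigma - y \in box_points (dual_weight k') (fun i => ~~ s' i) b.
  move=> hk' /(mem_box_points _ _ _ hb)[yB wy]; apply/mem_box_points => //.
  split; first exact: box_reflect.
  by have [] := w0_reflect hk' (psi_sigma _ _ yB) wy.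
have perm_pts : perm_eq (box_points (dual_weight k) (fun i => ~~ s i) b)
    [seq sigma - y | y <- box_points k s b].
  apply: uniq_perm; first by rewrite filter_uniq // fset_uniq.
    rewrite map_inj_uniq ?filter_uniq ?fset_uniq //.
    by move=> y z /addrI /oppr_inj.
  (* Surjectivity is the same inclusion for the dual weight and the negated flags, both operations
     being involutive. *)
  move=> y; apply/idP/mapP => [yB|[z zB ->]]; last exact: reflect_mem.
  exists (sigma - y); last by rewrite subKr.
  have := reflect_mem _ _ _ (dual_weight_range hk) yB.
  have sNN : (fun i => ~~ ~~ s i) = s by apply/funext => i; rewrite negbK.
  by rewrite dual_weightK //= sNN.
apply: (perm_trans (perm_map _ perm_pts)).
have -> : [seq Num.ceil (psi y) | y <- [seq sigma - y | y <- box_points k s b]] =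
    [seq dual_height k c | c <- heights k s b]; last exact: perm_refl.
rewrite -!map_comp; apply/eq_in_map => y /(mem_box_points _ _ _ hb)[yB wy] /=.
by have [] := w0_reflect hk (psi_sigma _ _ yB) wy.
Qed.

End Counting.

(** * Counting over a tiling of the space by half-open cones *)

Section Tiling.
Context {R : realType} {V : vectType R} {d : nat}.
Variables (N : set V) (psi : V -> R).
Hypothesis hN : lattice_of_rank d N.
Implicit Types (L : seq (d.-tuple V)) (S : d.-tuple V -> 'I_d -> bool).
Implicit Types (k : rat) (m : nat).

Definition tiles S L : Prop := forall x : V,
  exists2 b, b \in L /\ half_open (S b) b x &
    forall b', b' \in L -> half_open (S b') b' x -> b' = b.

(** On each tile [psi] is the sum of the coordinates, hence positively homogeneous; for [m > 0] it
    remains to divide by [m]. *)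
Lemma dilate_Qset L S m (x : V) :
  (forall b, b \in L -> cone_basis N psi b) -> tiles S L ->
  dilate m (Qset psi) x <-> psi x <= m%:R.
Proof.
move=> hL hS; have psiZ (c : R) y : 0 <= c -> psi (c *: y) = c * psi y.
  move=> c0; have [b [bL hy] _] := hS y; have [_ _ psiE] := hL _ bL.
  rewrite !psiE ?mulr_sumr => [|i|i]; last 2 first.
  - exact: half_open_ge0 hy.
  - by rewrite linearZ mulr_ge0 //; exact: half_open_ge0 hy.
  by apply: eq_bigr => i _; rewrite linearZ.
split=> [[y Qy <-]|xm].
  by rewrite psiZ ?ler0n // ler_piMr ?ler0n.
have [m0|m0] := posnP m; last first.
  have m_neq0 : m%:R != 0 :> R by rewrite pnatr_eq0 -lt0n.
  exists (m%:R^-1 *: x); last by rewrite scalerA divff ?scale1r.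
  by rewrite /Qset /= psiZ ?invr_ge0 ?ler0n // mulrC ler_pdivrMr ?ltr0n ?mul1r.
(* For [m = 0] the dilate is just the origin, so [psi x <= 0] has to force [x = 0]: nonnegative
   coordinates with sum zero all vanish. *)
have psi0 : psi 0 = 0 by rewrite -(scale0r 0) psiZ ?mul0r.
exists 0; first by rewrite /Qset /= psi0 ler01.
have [b [bL hx] _] := hS x; have [b_basis _ psiE] := hL _ bL.
have cx0 (i : 'I_d) : 0 <= coord b i x by exact: half_open_ge0 hx.
have psi_ge0 : 0 <= psi x by rewrite psiE // sumr_ge0.
have : psi x == 0 by move: xm; rewrite eq_le psi_ge0 andbT m0.
rewrite psiE // psumr_eq0 => [/allP x0|i _ //].
rewrite scaler0 (coord_basis b_basis (memvf x)) big1 // => i _.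
by have /eqP -> := x0 i (mem_index_enum i); rewrite scale0r.
Qed.

(** Disjointness of the tiles makes the concatenated list of points duplicate free, and covering
    makes it exhaustive. *)
Lemma f0_tiles L S k m : uniq L ->
  (forall b, b \in L -> cone_basis N psi b) -> tiles S L ->
  (f0 N psi k m)%:R =
  (\sum_(b <- L) \sum_(c <- heights N psi k (S b) b) binom_poly d c).[m%:R].
Proof.
move=> L_uniq hL hS; pose pts b := cone_points N psi k m (S b) b.
have mem_pts b x : b \in L -> x \in pts b <->
    [/\ N x, half_open (S b) b x, psi x <= m%:R & w0 psi x = ratr k].
  by move=> bL; apply: mem_cone_points => //; exact: hL.
rewrite /f0 (@card_fset_set_seq _ _ [seq x | b <- L, x <- pts b]).
- rewrite size_allpairs_dep sumnE big_map natr_sum horner_sum.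
  rewrite [LHS]big_seq [RHS]big_seq; apply: eq_bigr => b bL.
  by rewrite (size_cone_points_poly hN) //; exact: hL.
- apply: allpairs_uniq_dep => //.
    by move=> b bL; apply: (cone_points_uniq hN); exact: hL.
  move=> _ _ /allpairsPdep[b [x [bL xb ->]]] /allpairsPdep[b' [x' [bL' xb' ->]]] /=.
  move=> xx'; rewrite -{}xx' in xb' *.
  have [_ hx _ _] := (mem_pts _ _ bL).1 xb.
  have [_ hx' _ _] := (mem_pts _ _ bL').1 xb'.
  by have [b0 _ b0P] := hS x; rewrite (b0P _ bL hx) (b0P _ bL' hx').
- move=> x; split.
    move=> /allpairsPdep[b [y [bL /(mem_pts _ _ bL)[Nx hx xm wx] ->]]].
    by split=> //; apply/(dilate_Qset _ _ hL hS).
  move=> [/(dilate_Qset _ _ hL hS) xm Nx wx].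
  have [b [bL hx] _] := hS x.
  by apply/allpairsPdep; exists b, x; split=> //; apply/mem_pts.
Qed.

Lemma reciprocity_of_tiles L S : uniq L ->
    (forall b, b \in L -> cone_basis N psi b) ->
    tiles S L -> tiles (fun b i => ~~ S b i) L ->
  exists F : rat -> {poly rat}, forall k : rat, -1 < k <= 0 ->
    [/\ forall m : nat, (F k).[m%:R] = (f0 N psi k m)%:R,
        F k = 0 \/ (size (F k) = d.+1 /\ 0 < lead_coef (F k))
      & forall m : nat, (0 < m)%N ->
          (F k).[- m%:R] =
            if k == 0 then (-1) ^+ d * (F k).[m%:R - 1]
            else (-1) ^+ d * (F (-1 - k)).[m%:R]].
Proof.
move=> L_uniq hL hS hS'.
pose F S k := \sum_(b <- L) \sum_(c <- heights N psi k (S b) b) binom_poly d c.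
have FE S0 k m : tiles S0 L -> (F S0 k).[m%:R] = (f0 N psi k m)%:R.
  by move=> hS0; rewrite (f0_tiles k m L_uniq hL hS0).
(* Negating the argument replaces [c] by [d + 1 - c]. For [k = 0] the reflected height is [d - c],
   one less, and the discrepancy becomes the shift from [x] to [x - 1]. *)
have FN k x : -1 < k <= 0 -> (F S k).[- x] =
    (-1) ^+ d * (F (fun b i => ~~ S b i) (dual_weight k)).[if k == 0 then x - 1 else x].
  move=> hk; rewrite /F !horner_sum mulr_sumr [LHS]big_seq [RHS]big_seq.
  apply: eq_bigr => b bL.
  rewrite (perm_big _ (perm_heights hN (S b) hk (hL _ bL))) [in RHS]big_map.
  rewrite !horner_sum mulr_sumr; apply: eq_bigr => c _.
  rewrite binom_polyN /dual_height; case: eqP => // _.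
  by rewrite -binom_poly_shift addrAC.
exists (F S) => k hk; split.
- by move=> m; exact: FE.
- rewrite /F -(big_allpairs_dep (h := fun _ c => c)).
  exact: sum_binom_poly_lead.
(* The polynomials for [S] and for its negation both give [f0] at naturals, so they can be exchanged
   there; [0 < m] makes [m - 1] a natural. *)
move=> m m0; rewrite FN // /dual_weight; case: eqP => [->|_].
  by rewrite -[1]/(1%:R) -natrB // !FE.
by rewrite !FE.
Qed.

End Tiling.

(** * Generic vectors and behaviour for large [n] *)

(* Instead of x + eps w for small eps > 0 we use w + n x for large n. *)
Definition eventually (P : nat -> Prop) : Prop :=
  exists n0, forall n, (n0 <= n)%N -> P n.

Lemma eventually_all (T : eqType) (s : seq T) (P : T -> nat -> Prop) :
  (forall x, x \in s -> eventually (P x)) ->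
  eventually (fun n => forall x, x \in s -> P x n).
Proof.
elim: s => [|x s IHs] hs; first by exists 0%N.
have [n0 n0P] := hs x (mem_head x s).
have [|n1 n1P] := IHs; first by move=> y ys; apply: hs; rewrite in_cons ys orbT.
exists (maxn n0 n1) => n; rewrite geq_max => /andP[le0 le1] y.
by rewrite in_cons => /predU1P[->|ys]; [exact: n0P|exact: n1P].
Qed.

Section Generic.
Context {R : realType} {V : vectType R}.
Implicit Types (U : {vspace V}) (x y w : V).

(** If two distinct [n] gave points of [U], their difference would put [y], and then [x], in [U]. So
    at most one [n] is bad. *)
Lemma eventually_notin U x y : ~ (x \in U /\ y \in U) ->
  eventually (fun n => x + y *+ n \notin U).
Proof.
move=> xyU; have [[n xnU]|none] := pselect (exists n, x + y *+ n \in U); last first.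
  by exists 0%N => n _; apply/negP => xnU; apply: none; exists n.
exists n.+1 => m ltnm; apply/negP => xmU; apply: xyU.
have yU : y \in U.
  have mn0 : (m - n)%:R != 0 :> R by rewrite pnatr_eq0 subn_eq0 -ltnNge.
  rewrite -[y]scale1r -(mulVf mn0) -scalerA memvZ // scaler_nat.
  have -> : y *+ (m - n) = (x + y *+ m) - (x + y *+ n).
    by rewrite opprD addrACA subrr add0r mulrnBr // ltnW.
  exact: memvB.
split=> //; rewrite -[x](addrK (y *+ n)); apply: memvB => //.
by rewrite -scaler_nat memvZ.
Qed.

(** If [w] avoids [Us] but lies in [U], take [y] outside [U]: every [y + w *+ n] stays outside [U],
    and for large [n] it also avoids [Us]. *)
Lemma avoid_subspaces (Us : seq {vspace V}) :
  (forall U, U \in Us -> U != fullv) ->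
  exists w, forall U, U \in Us -> w \notin U.
Proof.
elim: Us => [|U Us IHUs] hUs; first by exists 0.
have [|w wUs] := IHUs.
  by move=> U' U'Us; apply: hUs; rewrite in_cons U'Us orbT.
have [wU|wU] := boolP (w \in U); last first.
  by exists w => U'; rewrite in_cons => /predU1P[->|/wUs].
have [y yU] : exists y, y \notin U.
  have /existsNP[y /negP yU] : ~ (forall y, y \in U); last by exists y.
  move=> allU; have /negP[] := hUs U (mem_head U Us).
  by apply/eqP/vspaceP => y; rewrite allU memvf.
have [|n0 n0P] := @eventually_all _ Us (fun U' n => y + w *+ n \notin U').
  by move=> U' /wUs wU'; apply: eventually_notin => -[_]; exact/negP.
exists (y + w *+ n0) => U'; rewrite in_cons => /predU1P[->|]; last exact: n0P.
by apply: contra yU => h; rewrite -[y](addrK (w *+ n0)) memvB // -scaler_nat memvZ.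
Qed.

(** A positive [c] eventually outweighs [e]; the case [c = 0] is allowed only for positive [e],
    which is the rule deciding which facets a tile keeps. *)
Lemma eventually_gt0 (c e : R) : e != 0 -> 0 < c ?<= if (0 < e) ->
  eventually (fun n => 0 < e + c *+ n).
Proof.
move=> e0 hc; have [c0|c0] := ltP 0 c; last first.
  exists 0%N => n _; have cE : c = 0.
    by apply/eqP; rewrite eq_le c0 (lteifW hc).
  by move: hc; rewrite cE mul0rn addr0 lteifxx.
exists (Num.bound (`|e| / c)) => n le_n.
have : `|e| / c < n%:R.
  apply: lt_le_trans (archi_boundP _) _; last by rewrite ler_nat.
  by rewrite divr_ge0 // ltW.
rewrite ltr_pdivrMr // mulr_natl => lt_en.
by rewrite -ltrBlDl sub0r; apply: le_lt_trans lt_en; rewrite -normrN ler_norm.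
Qed.

End Generic.

(** * Simplicial cones in coordinates, and their faces *)

Section Cones.
Context {R : realType} {V : vectType R}.
Implicit Types (x y w : V).

Lemma coneP n (b : n.-tuple V) x : cone b x <->
  exists2 c : 'I_n -> R, forall i, 0 <= c i & x = \sum_(i < n) c i *: b`_i.
Proof. by case: b => s sz; have E := eqP sz; subst n. Qed.

Lemma cone_coordP n (b : n.-tuple V) x : basis_of fullv b ->
  cone b x <-> forall i, 0 <= coord b i x.
Proof.
move=> b_basis; split=> [/coneP[c c0 ->] i|cx]; first by rewrite coord_sum_basis.
by apply/coneP; exists (coord b ^~ x) => //; exact: coord_basis (memvf x).
Qed.

Lemma cone_sub_span (s : seq V) x : cone s x -> x \in <<s>>%VS.
Proof.
move=> [c _ ->]; apply: memv_suml => i _; apply: memvZ.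
by apply: memv_span; rewrite mem_nth.
Qed.

(** A functional nonnegative on the generators and zero at a combination with all coefficients
    positive vanishes on each generator, hence on the whole cone. *)
Lemma face_interior n (b : n.-tuple V) (tau : set V) x : basis_of fullv b ->
  face tau (cone b) -> (forall i, 0 < coord b i x) -> tau x -> tau = cone b.
Proof.
move=> b_basis [u u0 ->] xi [_ /= ux0].
have ubi (i : 'I_n) : 0 <= u b`_i.
  by apply: u0; apply/cone_coordP => // j; rewrite coord_free ?(basis_free b_basis) ?ler0n.
have ub0 (i : 'I_n) : u b`_i = 0.
  move: ux0; rewrite {1}(coord_basis b_basis (memvf x)) linear_sum /= => /eqP.
  rewrite psumr_eq0 => [/allP/(_ i (mem_index_enum i))|j _].
    by rewrite linearZ /= mulf_eq0 gt_eqF //= => /eqP.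
  by rewrite linearZ /= mulr_ge0 // ltW.
apply/seteqP; split=> [y []//|y by_]; split=> //=.
rewrite (coord_basis b_basis (memvf y)) linear_sum big1 // => i _.
by rewrite linearZ /= ub0 mulr0.
Qed.

End Cones.

(** * Half-open tilings from a complete simplicial fan *)

Section FanTiling.
Context {R : realType} {V : vectType R} {d : nat}.
Hypothesis dim_V : \dim (fullv : {vspace V}) = d.
Variable C : seq (seq V).
Hypotheses (C_uniq : uniq C) (C_free : forall s, s \in C -> free s).
Hypothesis C_inj : forall s t, s \in C -> t \in C -> cone s = cone t -> s = t.
Hypothesis C_cover : forall x, exists2 s, s \in C & cone s x.
Hypothesis C_meet : forall s t, s \in C -> t \in C ->
  face (cone s `&` cone t) (cone s).
Implicit Types (x w : V).

(** [insub] keeps the generating lists of length [d], those of the full-dimensional cones. *)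
Definition full_cones : seq (d.-tuple V) := pmap insub C.

Lemma full_cones_uniq : uniq full_cones.
Proof. exact: pmap_sub_uniq. Qed.

Lemma mem_full_cones b : (b \in full_cones) = (val b \in C).
Proof. exact: mem_pmap_sub. Qed.

Lemma full_cones_basis b : b \in full_cones -> basis_of fullv b.
Proof.
rewrite mem_full_cones => /C_free b_free.
by rewrite basisEfree b_free subvf dim_V size_tuple leqnn.
Qed.

Definition generic w : Prop :=
  (forall s, s \in C -> size s != d -> w \notin <<s>>%VS) /\
  (forall b, b \in full_cones -> forall i, coord b i w != 0).

Lemma generic_exists : exists w, generic w.
Proof.
(* [R^o] is the field as a vector space over itself, so that the kernel of a coordinate is a
   subspace of [V]. *)
pose ker (b : d.-tuple V) i := lker (linfun (coord b i : V -> R^o)).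
have [|w wP] := @avoid_subspaces _ V ([seq <<s>>%VS | s <- C & size s != d] ++
    [seq ker b i | b <- full_cones, i <- enum 'I_d]).
  move=> U; rewrite mem_cat => /orP[/mapP[s]|/allpairsP[[b i] /= [bL _ ->]]].
    rewrite mem_filter => /andP[sz /C_free s_free] ->.
    by apply: contraNneq sz => E; rewrite -(eqP s_free) E dim_V.
  have b_free := basis_free (full_cones_basis bL).
  apply/eqP => E; have : b`_i \in ker b i by rewrite E memvf.
  by rewrite memv_ker lfunE /= coord_free // eqxx oner_eq0.
exists w; split=> [s sC sz|b bL i].
  by apply: wP; rewrite mem_cat map_f // mem_filter sz.
have : w \notin ker b i.
  by apply: wP; rewrite mem_cat; apply/orP; right; apply/allpairsP;
     exists (b, i); rewrite bL mem_enum.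
by rewrite memv_ker lfunE.
Qed.

Lemma genericN w : generic w -> generic (- w).
Proof.
move=> [w1 w2]; split=> [s sC sz|b bL i]; first by rewrite memvN w1.
by rewrite linearN oppr_eq0 w2.
Qed.

(** The tile of [x] is the full-dimensional cone that has [w + x *+ n] in its interior for all large
    [n]. *)
Lemma generic_tiles w : generic w ->
  tiles (fun b i => 0 < coord b i w) full_cones.
Proof.
move=> [w_span w_coord] x.
have eventually_pos b : b \in full_cones ->
    half_open (fun i => 0 < coord b i w) b x ->
    eventually (fun n => forall i, 0 < coord b i (w + x *+ n)).
  move=> bL /forallP hx.
  have [|n0 n0P] := @eventually_all _ (enum 'I_d) (fun i n => 0 < coord b i (w + x *+ n)).
    move=> i _; have [n0 n0P] := eventually_gt0 (w_coord _ bL i) (hx i).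
    by exists n0 => n /n0P; rewrite linearD linearMn.
  by exists n0 => n /n0P h i; apply: h; rewrite mem_enum.
have [[b [bL hb]]|none] := pselect (exists b, b \in full_cones /\
    half_open (fun i => 0 < coord b i w) b x).
  (* Uniqueness: some [z] is interior to both cones, so their intersection, a face of each, equals
     each. *)
  exists b => // b' b'L hb'.
  have [n0 n0P] := eventually_pos b bL hb; have [n1 n1P] := eventually_pos b' b'L hb'.
  pose n := maxn n0 n1; pose z := w + x *+ n.
  have zb : forall i, 0 < coord b i z by apply: n0P; rewrite leq_maxl.
  have zb' : forall i, 0 < coord b' i z by apply: n1P; rewrite leq_maxr.
  have cz : cone b z by apply/(cone_coordP _ (full_cones_basis bL)) => i; exact: ltW.
  have cz' : cone b' z by apply/(cone_coordP _ (full_cones_basis b'L)) => i; exact: ltW.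
  rewrite mem_full_cones in bL; rewrite mem_full_cones in b'L.
  apply/val_inj/C_inj => //.
  rewrite -(face_interior _ (C_meet bL b'L) zb) //; last first.
    by apply: full_cones_basis; rewrite mem_full_cones.
  rewrite setIC (face_interior _ (C_meet b'L bL) zb') //.
  by apply: full_cones_basis; rewrite mem_full_cones.
(* Existence: otherwise [w + x *+ n] leaves every cone of the finite list for large [n], against
   [C_cover]. *)
have [|n0 n0P] := @eventually_all _ C (fun s n => ~ cone s (w + x *+ n)); last first.
  by have [s sC] := C_cover (w + x *+ n0); have := n0P n0 (leqnn _) s sC.
move=> s sC; have [sz|sz] := eqVneq (size s) d; last first.
  have [|n0 n0P] := @eventually_notin _ _ <<s>>%VS w x.
    by move=> [ws _]; have /negP[] := w_span s sC sz.
  by exists n0 => n /n0P h /cone_sub_span; exact/negP.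
pose b : d.-tuple V := Tuple (introT eqP sz).
have bL : b \in full_cones by rewrite mem_full_cones.
have /existsNP[i /negP hi] : ~ (forall i, 0 < coord b i x ?<= if (0 < coord b i w)).
  by move=> h; apply: none; exists b; split=> //; exact/forallP.
(* Failure of the half-open condition at [i] is the same kind of condition on the opposite
   coordinates, so coordinate [i] becomes negative. *)
have [||n0 n0P] := @eventually_gt0 _ (- coord b i x) (- coord b i w).
- by rewrite oppr_eq0 w_coord.
- rewrite lteif0Nr oppr_gt0; move: hi; rewrite -lteifNE; congr (_ < _ ?<= if _).
  by have := w_coord b bL i; case: ltgtP.
exists n0 => n /n0P; rewrite mulNrn -opprD oppr_gt0 => lt0.
move=> /(cone_coordP (b := b) _ (full_cones_basis bL))/(_ i).
by rewrite linearD linearMn leNgt lt0.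
Qed.

(** No coordinate of [w] is zero, so negating the flags amounts to replacing [w] by [- w], which is
    again generic. *)
Lemma generic_tilesN w : generic w ->
  tiles (fun b i => ~~ (0 < coord b i w)) full_cones.
Proof.
move=> gw; have hE b x : b \in full_cones ->
    half_open (fun i => ~~ (0 < coord b i w)) b x =
    half_open (fun i => 0 < coord b i (- w)) b x.
  move=> bL; apply: eq_forallb => i; rewrite linearN oppr_gt0.
  by have := gw.2 b bL i; case: ltgtP.
move=> x; have [b [bL hb] bP] := generic_tiles (genericN gw) x.
exists b => [|b' b'L]; rewrite hE //; exact: bP.
Qed.

End FanTiling.

(** * Rays of simplicial cones and the choice of generators *)

Section Rays.
Context {R : realType} {V : vectType R}.
Implicit Types (x y : V).

Lemma cone1P x y : cone [:: y] x <-> exists2 c, 0 <= c & x = c *: y.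
Proof.
rewrite (coneP [tuple y]); split=> [[c c0 ->]|[c c0 ->]].
  by exists (c ord0) => //; rewrite big_ord1.
by exists (fun=> c) => //; rewrite big_ord1.
Qed.

(** The supporting functional is the sum of all coordinates except the [i]-th. *)
Lemma ray_face n (b : n.-tuple V) (i : 'I_n) : free b ->
  face (cone [:: b`_i]) (cone b).
Proof.
move=> b_free; pose f x := \sum_(j < n | j != i) coord b j x.
have f_lin : linear_for *%R f.
  move=> a x y; rewrite /f mulr_sumr -big_split; apply: eq_bigr => j _ /=.
  by rewrite linearP.
pose u : {scalar V} := HB.pack f (GRing.isLinear.Build R V R *%R f f_lin).
have fE (c : 'I_n -> R) : f (\sum_(j < n) c j *: b`_j) = \sum_(j < n | j != i) c j.
  by apply: eq_bigr => j _; rewrite coord_sum_free.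
exists u => [x /coneP[c c0 ->]|]; first by rewrite /= fE sumr_ge0.
apply/seteqP; split=> [x /cone1P[c c0 ->]|x [/coneP[c c0 ->]] /=].
  have E : c *: b`_i = \sum_(j < n) (if j == i then c else 0) *: b`_j.
    rewrite (bigD1 i) //= eqxx big1 ?addr0 // => j /negPf ->.
    by rewrite scale0r.
  rewrite E; split; last by rewrite /= fE big1 // => j /negPf ->.
  by apply/coneP; exists (fun j => if j == i then c else 0) => // j; case: ifP.
rewrite fE => /eqP; rewrite psumr_eq0 => [/allP c_eq0|j _ //].
apply/cone1P; exists (c i) => //.
rewrite (bigD1 i) //= big1 ?addr0 // => j ji.
by have := c_eq0 j (mem_index_enum j); rewrite ji => /eqP ->; rewrite scale0r.
Qed.

Lemma rescale_cone n (b : n.-tuple V) (y : 'I_n -> V) : free b ->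
    (forall i : 'I_n, exists c, 0 < c /\ b`_i = c *: y i) ->
  free [tuple y i | i < n] /\ cone b = cone [tuple y i | i < n].
Proof.
move=> b_free /choice[c cP].
have c0 i : 0 < c i by have [] := cP i.
have bE (i : 'I_n) : b`_i = c i *: y i by have [] := cP i.
have nthE (i : 'I_n) : [tuple y i | i < n]`_i = y i.
  by rewrite -tnth_nth tnth_mktuple.
have yE (i : 'I_n) : y i = (c i)^-1 *: b`_i by rewrite bE scalerA mulVf ?scale1r ?gt_eqF.
split.
  apply/freeP => k; under eq_bigr do rewrite nthE yE scalerA.
  move=> /(elimT freeP b_free) kc i.
  by have /eqP := kc i; rewrite mulf_eq0 invr_eq0 (gt_eqF (c0 i)) orbF => /eqP.
apply/seteqP; split=> x /coneP[k k0 ->]; apply/coneP.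
  exists (fun i => k i * c i) => [i|]; first by rewrite mulr_ge0 // ltW.
  by apply: eq_bigr => i _; rewrite nthE bE scalerA.
exists (fun i => k i / c i) => [i|]; first by rewrite divr_ge0 // ltW.
by apply: eq_bigr => i _; rewrite nthE yE scalerA.
Qed.

End Rays.

(** Each generator of a simplicial cone spans a face, hence a ray of the fan, so it is a positive
    multiple of some [b j]; replacing it by [b j] keeps the cone. *)
Lemma unit_generators (R : realType) (V : vectType R) (d : nat) (N : set V)
    (hN : lattice_of_rank d N)
    (Sigma : set (set V))
    (hfan : rational_fan N Sigma)
    (hsimplicial : simplicial_fan Sigma)
    (r : nat) (rho : 'I_r -> set V)
    (hrho : range rho = [set sigma | Sigma sigma /\ is_ray sigma])
    (v : 'I_r -> V)
    (hv : forall i, primitive N (v i) /\ rho i = cone [:: v i])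
    (a : 'I_r -> nat) (ha : forall i, (0 < a i)%N)
    (b : 'I_r -> V) (hb : forall i, b i = v i *+ a i)
    (psi : V -> R)
    (hpsi_b : forall i, psi (b i) = 1) (sigma : set V) :
  Sigma sigma -> exists s, [/\ free s, sigma = cone s &
    forall x, x \in s -> N x /\ psi x = 1].
Proof.
move=> sigmaS; have [s s_free sE] := hsimplicial sigma sigmaS.
pose t := in_tuple s; have t_free : free t by [].
have gen (i : 'I_(size s)) : exists j, exists c, 0 < c /\ t`_i = c *: b j.
  have ti0 : t`_i != 0 by by apply: (free_not0 t_free); rewrite mem_nth.
  have [j _ jE] : range rho (cone [:: t`_i]).
    rewrite hrho; split; last by exists t`_i.
    apply: (fan_face hfan sigmaS); rewrite sE; exact: (ray_face i t_free).
  have [_ rhoE] := hv j; exists j.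
  have : cone [:: v j] t`_i.
    by rewrite -rhoE jE; apply/cone1P; exists 1; rewrite ?scale1r.
  move=> /cone1P[c c0 tE]; have aj0 : (a j)%:R != 0 :> R.
    by rewrite pnatr_eq0 -lt0n.
  (* The ray is generated by [v j], and [b j] is [a j] times [v j]. *)
  exists (c / (a j)%:R); split.
    rewrite divr_gt0 ?ltr0n // lt_neqAle c0 andbT.
    by apply: contraNneq ti0 => E; rewrite tE -E scale0r.
  by rewrite hb -scaler_nat scalerA mulfVK.
have [j jP] := choice gen.
have [y_free yE] := rescale_cone t_free jP.
exists [tuple b (j i) | i < size s]; split=> //; first by rewrite sE -yE.
move=> x /mapP[i _ ->]; split; last exact: hpsi_b.
rewrite hb pmulrn; apply: (lattice_mulrz _ hN).
by have [[]] := hv (j i).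
Qed.

(** * From the fan to a list of cones with generators of height 1 *)

Theorem theorem3p7 (R : realType) (V : vectType R) (d : nat) (N : set V)
    (hN : lattice_of_rank d N)
    (Sigma : set (set V))
    (hfan : rational_fan N Sigma)
    (hsimplicial : simplicial_fan Sigma)
    (hcomplete : complete_fan Sigma)
    (r : nat) (rho : 'I_r -> set V)
    (hrho_inj : injective rho)
    (hrho : range rho = [set sigma | Sigma sigma /\ is_ray sigma])
    (v : 'I_r -> V)
    (hv : forall i, primitive N (v i) /\ rho i = cone [:: v i])
    (a : 'I_r -> nat) (ha : forall i, (0 < a i)%N)
    (b : 'I_r -> V) (hb : forall i, b i = v i *+ a i)
    (psi : V -> R)
    (hpsi_lin : linear_on_cones Sigma psi)
    (hpsi_b : forall i, psi (b i) = 1) :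
  exists F : rat -> {poly rat}, forall k : rat, -1 < k <= 0 ->
    [/\ forall m : nat, (F k).[m%:R] = (f0 N psi k m)%:R,
        F k = 0 \/ (size (F k) = d.+1 /\ 0 < lead_coef (F k))
      & forall m : nat, (0 < m)%N ->
          (F k).[- m%:R] =
            if k == 0 then (-1) ^+ d * (F k).[m%:R - 1]
            else (-1) ^+ d * (F (-1 - k)).[m%:R]].
Proof.
have [e e_basis _] := hN.
have dim_V : \dim (fullv : {vspace V}) = d.
  by rewrite -(span_basis e_basis) (eqP (basis_free e_basis)) size_tuple.
(* Fixing the generators as a function of the cone excludes two lists for the same cone, which is
   what [C_inj] needs. *)
have /choice[gen genP] : forall sigma, exists s, Sigma sigma ->
    [/\ free s, sigma = cone s & forall x, x \in s -> N x /\ psi x = 1].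
  move=> sigma; have [sigmaS|notS] := pselect (Sigma sigma); last by exists [::].
  by have [s sP] := unit_generators hN hfan hsimplicial hrho hv ha hb hpsi_b sigmaS; exists s.
have /finite_seqP[Ss SigmaE] := fan_finite hfan.
pose C := [seq gen sigma | sigma <- undup Ss].
have CP s : s \in C -> [/\ Sigma (cone s), s = gen (cone s), free s &
    forall x, x \in s -> N x /\ psi x = 1].
  move=> /mapP[sigma]; rewrite mem_undup => sigmaS ->.
  have {}sigmaS : Sigma sigma by rewrite SigmaE.
  by have [? <- ?] := genP _ sigmaS.
have C_inj s t : s \in C -> t \in C -> cone s = cone t -> s = t.
  by move=> /CP[_ sE _ _] /CP[_ tE _ _] st; rewrite sE st.
have C_uniq : uniq C.
  rewrite map_inj_in_uniq ?undup_uniq // => sigma tau; rewrite !mem_undup => sS tS.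
  have /genP[_ sE _] : Sigma sigma by rewrite SigmaE.
  have /genP[_ tE _] : Sigma tau by rewrite SigmaE.
  by move=> E; rewrite sE tE E.
have C_free s : s \in C -> free s by move=> /CP[].
have C_cover x : exists2 s, s \in C & cone s x.
  have : [set: V] x by []; rewrite -hcomplete => -[sigma sigmaS sx].
  have [_ E _] := genP _ sigmaS; exists (gen sigma); last by rewrite -E.
  by apply: map_f; move: sigmaS; rewrite SigmaE /= mem_undup.
have C_meet s t : s \in C -> t \in C -> face (cone s `&` cone t) (cone s).
  by move=> /CP[sS _ _ _] /CP[tS _ _ _]; have [] := fan_meet hfan sS tS.
have [w w_generic] := generic_exists dim_V C_free.
apply: (reciprocity_of_tiles hN (full_cones_uniq C_uniq) _
  (generic_tiles dim_V C_free C_inj C_cover C_meet w_generic)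
  (generic_tilesN dim_V C_free C_inj C_cover C_meet w_generic)).
move=> bb bbL; have bb_basis := full_cones_basis dim_V C_free bbL.
move: bbL; rewrite mem_full_cones => /CP[bbS _ _ bbP].
split=> [//|i|x cx].
  by apply: (bbP _ _).1; rewrite mem_nth ?size_tuple.
(* On this cone [psi] agrees with a linear [u], which equals 1 at each generator because the
   generators lie in the cone. *)
have [u uE] := hpsi_lin _ bbS.
have bb_cone (i : 'I_d) : cone bb bb`_i.
  apply/(cone_coordP _ bb_basis) => j.
  by rewrite coord_free ?ler0n // (basis_free bb_basis).
rewrite uE; last exact/(cone_coordP _ bb_basis).
rewrite {1}(coord_basis bb_basis (memvf x)) linear_sum; apply: eq_bigr => i _.
by rewrite linearZ /= -uE // (bbP _ _).2 ?mulr1 // mem_nth ?size_tuple.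
Qed.
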